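(* Let $1\le k\le N-1$, let $X=Gr(k,N)$ be the Grassmannian of complex $k$-planes in $\mathbb{C}^N$, and let $E=F_z\otimes H_\zeta^*\to X_z\times X_\zeta$ be the holomorphic vector bundle with section $\eta$ defined in the context. Then the section $\eta$ of $E$ is holomorphic and defines the diagonal $\Delta$ in $X\times X$, i.e. $\eta$ vanishes to the first order on $\Delta$ and is non-zero everywhere outside $\Delta$.
   Context: $H\to X$ is the tautological rank-$k$ bundle, viewed as a holomorphic subbundle of the trivial bundle $X\times\mathbb{C}^N$ (the fiber over $p$ is the $k$-plane corresponding to $p$), and $F=\mathbb{C}^N/H$ is the quotient bundle, of rank $N-k$. Points of $X\times X=X_z\times X_\zeta$ are written $(z,\zeta)$; subscripts $z$, $\zeta$ denote pull-backs of bundles under the projections to the first and the second factor respectively. The bundle $E=F_z\otimes H_\zeta^*\cong\mathrm{Hom}(H_\zeta,F_z)$ has rank $n=k(N-k)=\dim X$. The section $\eta$ of $E$ is defined as follows: a vector $v\in H_\zeta\subset\mathbb{C}^N$ is regarded as a vector $\tilde v$ in the trivial bundle $\mathbb{C}^N$ over $X_z$, and $\eta(v)$ is the image of $\tilde v$ under the projection $\mathbb{C}^N\to\mathbb{C}^N/H_z=F_z$. *)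

(* Defs.v *)
From HB Require Import structures.
From mathcomp Require Import all_boot all_order all_algebra ring_quotient.
From mathcomp Require Import all_classical all_reals all_analysis.
From mathcomp Require Import complex.
Set Implicit Arguments.
Unset Strict Implicit.
Unset Printing Implicit Defensive.

Import Order.TTheory GRing.Theory Num.Theory.
Import numFieldNormedType.Exports VectorInternalTheory.

Local Open Scope classical_set_scope.
Local Open Scope ring_scope.
Local Open Scope quotient_scope.

Section VectQuot.
Variables (K : fieldType) (V : vectType K) (U : {vspace V}).

(* ring_quotient provides the Z-module V / U; the rest of this section makes
   it a vector space, with vproj the canonical projection. *)
Definition vquot := Quotient.quot (pred_of_vspace U : zmodClosed V).
HB.instance Definition _ := Choice.on vquot.
HB.instance Definition _ := GRing.Zmodule.on vquot.
HB.instance Definition _ := EqQuotient.on vquot.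

Definition vproj (v : V) : vquot := \pi_vquot v.

Lemma vproj_eq u v : (vproj u == vproj v) = (u - v \in U).
Proof. by rewrite /vproj piE. Qed.

Lemma vproj_is_additive : zmod_morphism vproj.
Proof. by move=> u v; rewrite /vproj piE. Qed.

HB.instance Definition _ := GRing.isZmodMorphism.Build V vquot vproj vproj_is_additive.

Definition vquot_scale (c : K) (q : vquot) : vquot := vproj (c *: repr q).

Lemma vproj_scale c v : vproj (c *: v) = vquot_scale c (vproj v).
Proof.
apply/eqP; rewrite vproj_eq -scalerBr rpredZ// -vproj_eq.
by rewrite /vproj reprK.
Qed.

Lemma vprojP (q : vquot) : exists v, q = vproj v.
Proof. by exists (repr q); rewrite /vproj reprK. Qed.

Fact vquot_scaleA a b q :
  vquot_scale a (vquot_scale b q) = vquot_scale (a * b) q.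
Proof. by have [v ->] := vprojP q; rewrite -!vproj_scale scalerA. Qed.
Fact vquot_scale1 : left_id 1 vquot_scale.
Proof. by move=> q; have [v ->] := vprojP q; rewrite -vproj_scale scale1r. Qed.
Fact vquot_scaleDr : right_distributive vquot_scale +%R.
Proof.
move=> a p q; have [v ->] := vprojP q; have [u ->] := vprojP p.
by rewrite -raddfD -!vproj_scale scalerDr raddfD.
Qed.
Fact vquot_scaleDl q : {morph vquot_scale^~ q : a b / a + b}.
Proof.
by move=> a b; have [v ->] := vprojP q; rewrite -!vproj_scale scalerDl raddfD.
Qed.
HB.instance Definition _ := GRing.Zmodule_isLmodule.Build K vquot
  vquot_scaleA vquot_scale1 vquot_scaleDr vquot_scaleDl.
HB.instance Definition _ :=
  GRing.isScalable.Build K V vquot *:%R vproj vproj_scale.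


Let compl_part (v : V) : subvs_of (U^C)%VS := vsproj (U^C)%VS (v - projv U v).

Let compl_part_linear : linear compl_part.
Proof.
move=> a u v; rewrite /compl_part -linearP; congr (vsproj _ _).
by rewrite linearP scalerBr opprD addrACA.
Qed.

Let compl_part_repr v : compl_part (repr (vproj v)) = compl_part v.
Proof.
congr (vsproj _ _); apply/eqP; rewrite subr_eq.
have : repr (vproj v) - v \in U by rewrite -vproj_eq /vproj reprK.
move/projv_id; rewrite linearB/= => e.
by rewrite -addrA [- _ + _]addrC e addrC subrK.
Qed.

Fact vquot_vect_iso : Vector.axiom (dim (subvs_of (U^C)%VS)) vquot.
Proof.
exists (fun q => v2r (compl_part (repr q))).
  move=> a p q; have [v ->] := vprojP q; have [u ->] := vprojP p.
  by rewrite -linearP !compl_part_repr compl_part_linear linearP.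
exists (fun r => vproj (vsval (r2v r))) => [q|r].
  have [v ->] := vprojP q; rewrite compl_part_repr v2rK.
  apply/eqP; rewrite vproj_eq vsprojK ?memv_projC//.
  by rewrite addrAC subrr sub0r rpredN memv_proj.
rewrite compl_part_repr /compl_part (_ : projv U _ = 0) ?subr0 ?vsvalK ?r2vK//.
by apply/eqP; rewrite -memv_ker lker_proj subvsP.
Qed.
HB.instance Definition _ := Lmodule_hasFinDim.Build K vquot vquot_vect_iso.
End VectQuot.

Section MatrixDiff.
Variables (K : numFieldType) (V : normedModType K).

Lemma near_differentiable (W : normedModType K) (f g : V -> W) (x : V) :
  (\forall y \near x, f y = g y) -> differentiable f x -> differentiable g x.
Proof.
move=> fg df; have fgx : f x = g x by exact: nbhs_singleton fg.
have -> : g = f + (g - f) by apply/funext => y; rewrite !fctE addrC subrK.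
apply: differentiableD => //.
have [dc de] : continuous (\0 : V -> W) /\
    (g - f) \o shift x = cst ((g - f) x) + (\0 : V -> W) +o_ 0 id.
  split; first by apply: (@cst_continuous V W 0).
  apply/eqaddoP => e e0; move: fg; rewrite (near_shift 0 x) subr0.
  apply: filterS => y /= fgy; rewrite !fctE/= fgy -fgx !subrr addr0.
  by rewrite ?subr0 ?oppr0 normr0 mulr_ge0// ltW.
by apply/diff_locallyP; rewrite (diff_unique (df := \0) dc de).
Qed.

Lemma differentiable_mxP m n (M : V -> 'M[K]_(m, n)) (x : V) :
  (forall i j, differentiable (fun y => M y i j) x) -> differentiable M x.
Proof.
move=> dM.
have -> : M = \sum_(i < m) \sum_(j < n) (fun y => M y i j *: delta_mx i j).
  apply/funext => y; rewrite fct_sumE {1}(matrix_sum_delta (M y)).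
  by apply: eq_bigr => i _; rewrite fct_sumE.
apply: differentiable_sum => i; apply: differentiable_sum => j.
exact: differentiableZl.
Qed.

Lemma differentiable_entry m n (M : V -> 'M[K]_(m, n)) (x : V) i j :
  differentiable M x -> differentiable (fun y => M y i j) x.
Proof. by move=> dM; apply: differentiable_comp dM (differentiable_coord _ _ _). Qed.

Lemma differentiable_mulmx m n p (A : V -> 'M[K]_(m, n)) (B : V -> 'M[K]_(n, p))
    (x : V) : differentiable A x -> differentiable B x ->
  differentiable (fun y => A y *m B y) x.
Proof.
move=> dA dB; apply: differentiable_mxP => i j.
have -> : (fun y => (A y *m B y) i j) =
    \sum_(l < n) ((fun y => A y i l) * (fun y => B y l j)).
  by apply/funext => y; rewrite mxE fct_sumE.
apply: differentiable_sum => l.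
by apply: differentiableM; exact: differentiable_entry.
Qed.

Lemma differentiable_prod (I : Type) (s : seq I) (f : I -> V -> K) (x : V) :
  (forall i, differentiable (f i) x) ->
  differentiable (fun y => \prod_(i <- s) f i y) x.
Proof.
move=> df; elim: s => [|i s ih].
  by under eq_fun do rewrite big_nil; exact: differentiable_cst.
under eq_fun do rewrite big_cons.
exact: (differentiableM (df i) ih).
Qed.

Lemma differentiable_fsum (I : Type) (s : seq I) (W : normedModType K)
    (f : I -> V -> W) (x : V) :
  (forall i, differentiable (f i) x) ->
  differentiable (fun y => \sum_(i <- s) f i y) x.
Proof.
move=> df; elim: s => [|i s ih].
  by under eq_fun do rewrite big_nil; exact: differentiable_cst.
under eq_fun do rewrite big_cons.
exact: (differentiableD (df i) ih).
Qed.

Lemma differentiable_det n (M : V -> 'M[K]_n) (x : V) :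
  differentiable M x -> differentiable (fun y => \det (M y)) x.
Proof.
move=> dM; apply: differentiable_fsum => s.
apply: (@differentiableM _ _ (cst _)); first exact: differentiable_cst.
by apply: differentiable_prod => i; exact: differentiable_entry.
Qed.

Lemma near_unitmx n (M : V -> 'M[K]_n) (x : V) : differentiable M x ->
  M x \in unitmx -> \forall y \near x, M y \in unitmx.
Proof.
move=> dM; rewrite unitmxE unitfE => Mx.
have /differentiable_continuous dc := differentiable_det dM.
have : \forall y \near x, \det (M y) != 0 by exact: (cvgr_neq0 _ dc Mx).
apply: filterS => y /=.
by rewrite unitmxE unitfE.
Qed.

Lemma differentiable_invmx n (M : V -> 'M[K]_n) (x : V) : differentiable M x ->
  M x \in unitmx -> differentiable (fun y => invmx (M y)) x.
Proof.
move=> dM Mx; have Mx0 : \det (M x) != 0 by rewrite -unitfE -unitmxE.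
have e : \forall y \near x, (\det (M y))^-1 *: \adj (M y) = invmx (M y).
  by apply: filterS (near_unitmx dM Mx) => y My; rewrite /invmx My.
apply: near_differentiable e _; apply: differentiable_mxP => i j.
under eq_fun do rewrite !mxE.
apply: (@differentiableM _ _ (fun y => (\det (M y))^-1)).
  by apply: differentiableV => //; exact: differentiable_det.
apply: (@differentiableM _ _ (cst _)); first exact: differentiable_cst.
apply: differentiable_det; apply: differentiable_mxP => a b.
under eq_fun do rewrite !mxE; exact: differentiable_entry.
Qed.

End MatrixDiff.

Section Atlas.
Variable R : realType.
Local Notation C := R[i].

(* A holomorphic atlas on X modelled on V, given by the inverses
   [param c] of the charts; [chart_img c] is the image of the c-th chart.
   In [param_compat], h is the change of coordinates. *)
Record holoAtlas (V : normedModType C) (X : Type) := HoloAtlas {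
  chart_index : Type;
  chart_img : chart_index -> set V;
  param : chart_index -> V -> X;
  chart_img_open : forall c, open (chart_img c);
  param_inj : forall c u v, chart_img c u -> chart_img c v ->
    param c u = param c v -> u = v;
  param_cover : forall x, exists c, exists2 u, chart_img c u & param c u = x;
  param_compat : forall c d u v, chart_img c u -> chart_img d v ->
    param c u = param d v ->
    exists h : V -> V, \forall w \near u,
      [/\ chart_img d (h w), param d (h w) = param c w & differentiable h w]
}.

Arguments chart_img {V X} A c _ : rename.
Arguments param {V X} A c _ : rename.

Definition open_in (V : normedModType C) X (A : holoAtlas V X) (D : set X) :=
  forall c u, chart_img A c u -> D (param A c u) ->
    \forall w \near u, D (param A c w).

(* Complex differentiability at x in all local coordinates; a function is
   holomorphic on an open set when this holds at each of its points. *)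
Definition holo_at (V W : normedModType C) X (A : holoAtlas V X) (f : X -> W)
    (x : X) :=
  forall c u, chart_img A c u -> param A c u = x ->
    differentiable (fun w => f (param A c w)) u.

Definition holo_map (V W : normedModType C) X Y (A : holoAtlas V X)
    (B : holoAtlas W Y) (f : X -> Y) :=
  forall c u d v, chart_img A c u -> chart_img B d v ->
    f (param A c u) = param B d v ->
    exists2 h : V -> W, differentiable h u &
      \forall w \near u, chart_img B d (h w) /\ param B d (h w) = f (param A c w).

(* The matrix of g \o f^-1 in the row vector convention. *)
Definition trans_mx (E : vectType C) r (f g : 'Hom(E, 'rV[C]_r)) : 'M[C]_r :=
  lin1_mx (g \o f^-1)%VF.

(* A holomorphic vector bundle of rank r over (X, A): a family of vector
   spaces with local trivialisations over open sets, whose transition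
   matrices are holomorphic.  The values of [triv t x] for x outside of
   [triv_dom t] are irrelevant. *)
Record holoBundle (V : normedModType C) X (A : holoAtlas V X) (r : nat) :=
  HoloBundle {
    fiber : X -> vectType C;
    triv_index : Type;
    triv_dom : triv_index -> set X;
    triv : forall (t : triv_index) (x : X), 'Hom(fiber x, 'rV[C]_r);
    triv_dom_open : forall t, open_in A (triv_dom t);
    triv_cover : forall x, exists t, triv_dom t x;
    triv_bij : forall t x, triv_dom t x -> bijective (triv t x);
    triv_compat : forall s t x, triv_dom s x -> triv_dom t x ->
      holo_at A (fun y => trans_mx (triv s y) (triv t y)) x
  }.

Arguments triv_dom {V X A r} E t _ : rename.
Arguments triv {V X A r} E t x : rename.

Definition holo_section (V : normedModType C) X (A : holoAtlas V X) r
    (E : holoBundle A r)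
    (s : forall x, fiber E x) :=
  forall t x, triv_dom E t x -> holo_at A (fun y => triv E t y (s y)) x.

(* s vanishes on D and, in all local coordinates and all local
   trivialisations, its differential at the points of D is onto, that is, the
   differentials of the r components of s are linearly independent.  This is
   the meaning of first order vanishing for D of codimension r. *)
Definition vanishes_first_order (V : normedModType C) X (A : holoAtlas V X) r
    (E : holoBundle A r)
    (s : forall x, fiber E x) (D : set X) :=
  forall x, D x -> s x = 0 /\
    forall c u t, chart_img A c u -> param A c u = x -> triv_dom E t x ->
      let f := fun w => triv E t (param A c w) (s (param A c w)) in
      differentiable f u /\ range ('d f u) = setT.

Section HomBijection.
Variables (E F : vectType C) (f : 'Hom(E, F)).

Lemma hom_bij_invK : bijective f -> cancel f f^-1%VF.
Proof. by move/bij_inj/lker0P/lker0_lfunK. Qed.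

Lemma hom_bij_invVK : bijective f -> cancel f^-1%VF f.
Proof.
move=> [f' fK f'K] x; apply: limg_lfunVK.
by apply/memv_imgP; exists (f' x); rewrite ?memvf// f'K.
Qed.

Lemma hom_bijP : (forall v, f v = 0 -> v = 0) ->
  (forall w, exists v, w = f v) -> bijective f.
Proof.
move=> f0 fS; exists f^-1%VF => [|w].
  apply: lker0_lfunK; apply/lker0P => u v /eqP.
  by rewrite -subr_eq0 -linearB => /eqP/f0/eqP; rewrite subr_eq0 => /eqP.
have [v ->] := fS w; apply: limg_lfunVK.
by apply/memv_imgP; exists v; rewrite ?memvf.
Qed.

Lemma hom_inv_bij : bijective f -> bijective f^-1%VF.
Proof. by move=> bf; exists f; [exact: hom_bij_invVK|exact: hom_bij_invK]. Qed.

End HomBijection.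

Section TransMx.
Variables (E : vectType C) (r : nat).
Implicit Types f g : 'Hom(E, 'rV[C]_r).

Lemma trans_mxE f g v : bijective f -> f v *m trans_mx f g = g v.
Proof. by move=> bf; rewrite mul_rV_lin1 /= comp_lfunE hom_bij_invK. Qed.

Lemma trans_mx_eq f g M : bijective f -> (forall v, g v = f v *m M) ->
  trans_mx f g = M.
Proof.
move=> bf gM; apply/row_matrixP => i; rewrite !rowE.
by rewrite mul_rV_lin1 /= comp_lfunE gM hom_bij_invVK.
Qed.

End TransMx.

Section Prod.
Variables (V W : normedModType C) (X Y : Type).
Variables (A : holoAtlas V X) (B : holoAtlas W Y).

Let img (c : chart_index A * chart_index B) : set (V * W) :=
  [set u | chart_img A c.1 u.1 /\ chart_img B c.2 u.2].
Let par (c : chart_index A * chart_index B) (u : V * W) : X * Y :=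
  (param A c.1 u.1, param B c.2 u.2).

Lemma near_fst (u : V * W) (P : set V) :
  (\forall x \near u.1, P x) -> \forall w \near u, P w.1.
Proof. by move=> Pu; exact: (@cvg_fst _ _ (nbhs u.1) (nbhs u.2) _ P Pu). Qed.

Lemma near_snd (u : V * W) (P : set W) :
  (\forall x \near u.2, P x) -> \forall w \near u, P w.2.
Proof. by move=> Pu; exact: (@cvg_snd _ _ (nbhs u.1) (nbhs u.2) _ P Pu). Qed.

Let img_open c : open (img c).
Proof.
rewrite openE => u [u1 u2]; rewrite /interior; near=> w; split; near: w.
  by apply: near_fst; exact: open_nbhs_nbhs (conj (chart_img_open _) u1).
by apply: near_snd; exact: open_nbhs_nbhs (conj (chart_img_open _) u2).
Unshelve. all: by end_near. Qed.

Let par_inj c u v : img c u -> img c v -> par c u = par c v -> u = v.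
Proof.
case: u v => u1 u2 [v1 v2] [/= a1 a2] [/= b1 b2] [e1 e2].
by rewrite (param_inj a1 b1 e1) (param_inj a2 b2 e2).
Qed.

Let par_cover x : exists c, exists2 u, img c u & par c u = x.
Proof.
case: x => x y; have [c [u cu <-]] := param_cover A x.
have [d [v dv <-]] := param_cover B y.
by exists (c, d), (u, v).
Qed.

Lemma differentiable_fst (u : V * W) : differentiable (@fst V W) u.
Proof. by apply: linear_differentiable => v P; exact: near_fst. Qed.

Lemma differentiable_snd (u : V * W) : differentiable (@snd V W) u.
Proof. by apply: linear_differentiable => v P; exact: near_snd. Qed.

Let par_compat c d u v : img c u -> img d v -> par c u = par d v ->
  exists h : V * W -> V * W, \forall w \near u,
      [/\ img d (h w), par d (h w) = par c w & differentiable h w].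
Proof.
move=> [c1 c2] [d1 d2] [e1 e2].
have [h1 P1] := param_compat c1 d1 e1; have [h2 P2] := param_compat c2 d2 e2.
exists (fun w => (h1 w.1, h2 w.2)).
have {}P1 := near_fst P1.
have {}P2 := near_snd P2.
apply: filterS2 P1 P2 => w [i1 f1 g1] [i2 f2 g2].
split; [by []|by rewrite /par /= f1 f2|].
apply: differentiable_pair.
  exact: differentiable_comp (differentiable_fst w) g1.
exact: differentiable_comp (differentiable_snd w) g2.
Qed.

Definition prod_atlas : holoAtlas (V * W)%type (X * Y) :=
  HoloAtlas img_open par_inj par_cover par_compat.

Lemma holo_map_fst : holo_map prod_atlas A fst.
Proof.
move=> c u d v [cu1 cu2] dv e.
have [h P] := param_compat cu1 dv e.
exists (fun w => h w.1).
  have [_ _ dh] := nbhs_singleton P.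
  exact: differentiable_comp (differentiable_fst u) dh.
by apply: filterS (near_fst P) => w [].
Qed.

Lemma holo_map_snd : holo_map prod_atlas B snd.
Proof.
move=> c u d v [cu1 cu2] dv e.
have [h P] := param_compat cu2 dv e.
exists (fun w => h w.2).
  have [_ _ dh] := nbhs_singleton P.
  exact: differentiable_comp (differentiable_snd u) dh.
by apply: filterS (near_snd P) => w [].
Qed.

End Prod.

Section Pullback.
Variables (V W : normedModType C) (X Y : Type).
Variables (A : holoAtlas V X) (B : holoAtlas W Y) (f : X -> Y).
Hypothesis hf : holo_map A B f.

Lemma holo_at_comp (U : normedModType C) (g : Y -> U) x :
  holo_at B g (f x) -> holo_at A (g \o f) x.
Proof.
move=> hg c u cu ux; have [d [v dv vfx]] := param_cover B (f x).
have [|h dh P] := hf cu dv; first by rewrite ux vfx.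
have [ih eh] := nbhs_singleton P.
have hv : h u = v by apply: param_inj ih dv _; rewrite eh ux vfx.
have dg : differentiable (fun w => g (param B d w)) (h u).
  by apply: hg; rewrite // hv.
apply: near_differentiable (differentiable_comp dh dg).
by apply: filterS P => w [_ /= ->].
Qed.

Lemma open_in_preimage D : open_in B D -> open_in A (f @^-1` D).
Proof.
move=> oD c u cu Du; have [d [v dv vfx]] := param_cover B (f (param A c u)).
have [|h dh P] := hf cu dv; first by rewrite vfx.
have [ih eh] := nbhs_singleton P.
have dc : h @ u --> h u := differentiable_continuous dh.
have Dh : \forall w \near h u, D (param B d w) by apply: oD => //; rewrite eh.
by apply: filterS2 P (dc _ Dh) => w [_ e] /=; rewrite e.
Qed.

Variables (r : nat) (E : holoBundle B r).

Let ptriv (t : triv_index E) x : 'Hom(fiber E (f x), 'rV[C]_r) :=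
  triv E t (f x).
Let pdom (t : triv_index E) : set X := f @^-1` triv_dom E t.

Let pdom_open t : open_in A (pdom t).
Proof. by apply: open_in_preimage; exact: triv_dom_open. Qed.
Let pcover x : exists t, pdom t x.
Proof. exact: triv_cover. Qed.
Let pbij t x : pdom t x -> bijective (ptriv t x).
Proof. exact: triv_bij. Qed.
Let pcompat s t x : pdom s x -> pdom t x ->
  holo_at A (fun y => trans_mx (ptriv s y) (ptriv t y)) x.
Proof.
move=> sx tx.
exact: (holo_at_comp (g := fun y => trans_mx (triv E s y) (triv E t y))
  (triv_compat sx tx)).
Qed.

Definition pullback_bundle : holoBundle A r :=
  @HoloBundle _ _ A r (fun x => fiber E (f x)) _ pdom ptriv
    pdom_open pcover pbij pcompat.

End Pullback.

Section HomBundle.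
Variables (V : normedModType C) (X : Type) (A : holoAtlas V X) (r s : nat).
Variables (E : holoBundle A r) (F : holoBundle A s).

Section HomCoord.
Variables (T U : vectType C) (f : 'Hom(T, 'rV[C]_r)) (g : 'Hom(U, 'rV[C]_s)).

Definition hom_coord (phi : 'Hom(T, U)) : 'rV[C]_(r * s) :=
  mxvec (lin1_mx (g \o phi \o f^-1)%VF).

Fact hom_coord_linear : linear hom_coord.
Proof.
move=> a u v; rewrite /hom_coord -linearP; congr mxvec.
apply/row_matrixP => i; rewrite !rowE mulmxDr -scalemxAr !mul_rV_lin1 /=.
by rewrite !comp_lfunE !lfunE /= !lfunE linearP.
Qed.
HB.instance Definition _ :=
  GRing.isLinear.Build C 'Hom(T, U) 'rV[C]_(r * s) _ hom_coord
    hom_coord_linear.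

Lemma hom_coordE phi v : bijective f ->
  f v *m vec_mx (hom_coord phi) = g (phi v).
Proof.
by move=> bf; rewrite mxvecK mul_rV_lin1 /= !comp_lfunE hom_bij_invK.
Qed.

Lemma hom_coord_bij : bijective f -> bijective g -> bijective hom_coord.
Proof.
move=> bf bg.
exists (fun M => g^-1 \o linfun (mulmxr (vec_mx M)) \o f)%VF => [phi|M].
  apply/lfunP => v; rewrite !comp_lfunE lfunE /= hom_coordE//.
  by rewrite hom_bij_invK.
rewrite -[RHS]vec_mxK; congr mxvec; apply/row_matrixP => i.
rewrite !rowE mul_rV_lin1 /= !comp_lfunE lfunE /=.
by rewrite !hom_bij_invVK.
Qed.

End HomCoord.

Let idx := (triv_index E * triv_index F)%type.
Let hdom (t : idx) : set X := triv_dom E t.1 `&` triv_dom F t.2.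
Let htriv (t : idx) x : 'Hom('Hom(fiber E x, fiber F x), 'rV[C]_(r * s)) :=
  linfun (hom_coord (triv E t.1 x) (triv F t.2 x)).

Let htrivE t x phi :
  htriv t x phi = hom_coord (triv E t.1 x) (triv F t.2 x) phi.
Proof. by rewrite lfunE. Qed.

Let hdom_open t : open_in A (hdom t).
Proof.
move=> c u cu [u1 u2].
exact: filterI (triv_dom_open cu u1) (triv_dom_open cu u2).
Qed.

Let hcover x : exists t, hdom t x.
Proof.
have [t1 h1] := triv_cover E x; have [t2 h2] := triv_cover F x.
by exists (t1, t2).
Qed.

Let hbij t x : hdom t x -> bijective (htriv t x).
Proof.
move=> [h1 h2]; apply: eq_bij (hom_coord_bij (triv_bij h1) (triv_bij h2)) _ _.
by move=> phi; rewrite lfunE.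
Qed.

Let hcompat t1 t2 x : hdom t1 x -> hdom t2 x ->
  holo_at A (fun y => trans_mx (htriv t1 y) (htriv t2 y)) x.
Proof.
move=> h1 h2 c u cu ux.
pose G y := trans_mx (triv E t2.1 y) (triv E t1.1 y).
pose H y := trans_mx (triv F t1.2 y) (triv F t2.2 y).
have dG : differentiable (fun w => G (param A c w)) u.
  by apply: (triv_compat (x := x)) => //; [case: h2|case: h1].
have dH : differentiable (fun w => H (param A c w)) u.
  by apply: (triv_compat (x := x)) => //; [case: h1|case: h2].
pose M y : 'M[C]_(r * s) :=
  \matrix_i mxvec (G y *m vec_mx (delta_mx 0 i) *m H y).
have dM : differentiable (fun w => M (param A c w)) u.
  apply: differentiable_mxP => i j; under eq_fun do rewrite mxE.
  case/mxvec_indexP: j => a b; under eq_fun do rewrite mxvecE.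
  apply: differentiable_entry; apply: differentiable_mulmx => //.
  by apply: differentiable_mulmx => //; exact: differentiable_cst.
apply: near_differentiable dM.
have n1 := hdom_open cu (eq_ind_r _ h1 ux).
have n2 := hdom_open cu (eq_ind_r _ h2 ux).
apply: filterS2 n1 n2 => w k1 k2; apply/esym/trans_mx_eq; first exact: hbij.
move: (param A c w) k1 k2 => y k1 k2 phi.
rewrite [LHS]htrivE [X in X *m _]htrivE.
have ML q : q *m M y = mxvec (G y *m vec_mx q *m H y).
  rewrite {2}(row_sum_delta q) !linear_sum /= mulmx_suml linear_sum /=.
  rewrite mulmx_sum_row; apply: eq_bigr => i _.
  by rewrite rowK !linearZ /= -!scalemxAl linearZ.
rewrite [RHS]ML.
rewrite -[LHS]vec_mxK.
congr mxvec.
have [k11 k12] := k1; have [k21 k22] := k2.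
apply/row_matrixP => i; rewrite !rowE.
have [v ->] : exists v, delta_mx 0 i = triv E t2.1 y v.
  by exists ((triv E t2.1 y)^-1%VF (delta_mx 0 i));
    rewrite hom_bij_invVK//; exact: triv_bij.
rewrite hom_coordE; last exact: triv_bij.
rewrite !mulmxA trans_mxE; last exact: triv_bij.
rewrite hom_coordE; last exact: triv_bij.
by rewrite trans_mxE//; exact: triv_bij.
Qed.

Definition hom_bundle : holoBundle A (r * s) :=
  @HoloBundle _ _ A _ (fun x => 'Hom(fiber E x, fiber F x)) _ hdom htriv
    hdom_open hcover hbij hcompat.

End HomBundle.
End Atlas.

Section Grassmannian.
Variables (R : realType) (k N : nat).
Local Notation C := R[i].

Definition Gr := {p : {vspace 'rV[C]_N} | \dim p == k}.

Definition rowspan m (M : 'M[C]_(m, N)) : {vspace 'rV[C]_N} :=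
  limg (linfun (mulmxr M : 'rV[C]_m -> 'rV[C]_N)).

Lemma mem_rowspan m (M : 'M[C]_(m, N)) v : (v \in rowspan M) = (v <= M)%MS.
Proof.
apply/memv_imgP/submxP => [[x _ ->]|[x ->]]; exists x; rewrite ?memvf//.
  by rewrite lfunE.
by rewrite lfunE.
Qed.

Lemma rowspan_subP m m' (M : 'M[C]_(m, N)) (M' : 'M[C]_(m', N)) :
  reflect (exists Q, M = Q *m M') (rowspan M <= rowspan M')%VS.
Proof.
apply: (iffP subvP) => [MM'|[Q ->] v].
  apply/submxP/row_subP => i; rewrite -mem_rowspan; apply: MM'.
  by rewrite mem_rowspan row_sub.
by rewrite !mem_rowspan => /submx_trans; apply; exact: submxMl.
Qed.

Lemma dim_rowspan m (M : 'M[C]_(m, N)) : row_free M -> \dim (rowspan M) = m.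
Proof.
move=> Mf; rewrite /rowspan limg_dim_eq ?dimvf ?/dim/= ?mul1n//.
apply/eqP; rewrite -subv0; apply/subvP => v; rewrite memv_cap memvf memv_ker.
rewrite lfunE /= memv0 => /eqP v0; apply/eqP.
by apply: (row_free_inj Mf); rewrite v0 mul0mx.
Qed.

Lemma rowspan_basis (U : {vspace 'rV[C]_N}) m : \dim U = m ->
  exists2 M : 'M[C]_(m, N), row_free M & rowspan M = U.
Proof.
move=> <-; pose M : 'M[C]_(\dim U, N) := \matrix_i (vbasis U)`_i.
have ME (x : 'rV_(\dim U)) : x *m M = \sum_i x 0 i *: (vbasis U)`_i.
  by rewrite mulmx_sum_row; apply: eq_bigr => i _; rewrite rowK.
exists M.
  apply: inj_row_free => x; rewrite ME => x0; apply/rowP => i; rewrite mxE.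
  by move/freeP : (basis_free (vbasisP U)); apply.
apply/vspaceP => v; rewrite mem_rowspan; apply/submxP/idP => [[x ->]|vU].
  rewrite ME; apply: rpred_sum => i _; rewrite rpredZ// vbasis_mem//.
  by rewrite mem_nth// size_tuple.
exists (\row_i coord (vbasis U) i v); rewrite ME {1}(coord_vbasis vU).
by apply: eq_bigr => i _; rewrite mxE.
Qed.

(* The affine charts: for a basis of C^N split into k vectors (the rows of A)
   and N - k vectors (the rows of B), a k x (N - k) matrix Z is sent to the
   plane spanned by the rows of A + Z B.  The usual charts are obtained when
   the basis is a permutation of the standard one. *)
Definition gr_chart := {AB : 'M[C]_(k, N) * 'M[C]_(N - k, N) |
  row_free (col_mx AB.1 AB.2)}.

Section Chart.
Variable c : gr_chart.

Definition chA : 'M[C]_(k, N) := (sval c).1.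
Definition chB : 'M[C]_(N - k, N) := (sval c).2.

(* The coordinates of v in the basis are (v a, v b). *)
Definition cha : 'M[C]_(N, k) := lsubmx (pinvmx (col_mx chA chB)).
Definition chb : 'M[C]_(N, N - k) := rsubmx (pinvmx (col_mx chA chB)).

Let chM : col_mx chA chB *m row_mx cha chb = 1%:M.
Proof. by rewrite hsubmxK mulmxVp//; exact: (svalP c). Qed.

Let chM4 : [/\ chA *m cha = 1%:M, chA *m chb = 0,
  chB *m cha = 0 & chB *m chb = 1%:M].
Proof.
by move: chM; rewrite mul_col_row scalar_mx_block => /eq_block_mx.
Qed.

Lemma chAa : chA *m cha = 1%:M. Proof. by have [] := chM4. Qed.
Lemma chAb : chA *m chb = 0. Proof. by have [] := chM4. Qed.
Lemma chBa : chB *m cha = 0. Proof. by have [] := chM4. Qed.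
Lemma chBb : chB *m chb = 1%:M. Proof. by have [] := chM4. Qed.

Lemma ch1 : cha *m chA + chb *m chB = 1%:M.
Proof.
rewrite -mul_row_col hsubmxK mulVpmx// /row_full eqn_leq rank_leq_col /=.
have /eqP -> : row_free (col_mx chA chB) by exact: (svalP c).
by rewrite -leq_subLR.
Qed.

Definition chP (Z : 'M[C]_(k, N - k)) : 'M[C]_(k, N) := chA + Z *m chB.

Lemma chPa Z : chP Z *m cha = 1%:M.
Proof. by rewrite mulmxDl chAa -mulmxA chBa mulmx0 addr0. Qed.

Lemma chPb Z : chP Z *m chb = Z.
Proof. by rewrite mulmxDl chAb -mulmxA chBb mulmx1 add0r. Qed.

Lemma chP_free Z : row_free (chP Z).
Proof. by apply/row_freeP; exists cha; exact: chPa. Qed.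

Fact chP_dim Z : \dim (rowspan (chP Z)) == k.
Proof. by rewrite dim_rowspan ?chP_free. Qed.

Definition gr_param Z : Gr := exist _ (rowspan (chP Z)) (chP_dim Z).

Definition gr_dom : set Gr := range gr_param.

Lemma gr_param_inj Z Z' : gr_param Z = gr_param Z' -> Z = Z'.
Proof.
move=> /(congr1 sval)/= /eqP; rewrite eqEsubv => /andP[/rowspan_subP[Q e] _].
have := congr1 (mulmx^~ cha) e; rewrite -mulmxA !chPa mulmx1 => e1.
by have := congr1 (mulmx^~ chb) e; rewrite -mulmxA !chPb -e1 mul1mx.
Qed.

(* The coordinate of the plane spanned by the rows of P. *)
Definition gr_coord (P : 'M[C]_(k, N)) : 'M[C]_(k, N - k) :=
  invmx (P *m cha) *m (P *m chb).

Lemma rowspan_coord P : P *m cha \in unitmx ->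
  rowspan (chP (gr_coord P)) = rowspan P.
Proof.
move=> u; have e : chP (gr_coord P) = invmx (P *m cha) *m P.
  rewrite /chP -{1}[chA]mul1mx -(mulVmx u) /gr_coord -!mulmxA -mulmxDr.
  by rewrite -mulmxDr ch1 mulmx1.
apply/eqP; rewrite eqEsubv; apply/andP; split; apply/rowspan_subP.
  by exists (invmx (P *m cha)).
by exists (P *m cha); rewrite e mulKVmx.
Qed.

Lemma gr_dom_unit P Z : rowspan P = rowspan (chP Z) -> P *m cha \in unitmx.
Proof.
move=> /eqP; rewrite eqEsubv => /andP[_ /rowspan_subP[Q e]].
have := congr1 (mulmx^~ cha) e; rewrite -mulmxA chPa => /esym.
by move/mulmx1_unit => [].
Qed.

Lemma differentiable_chP (Z : ('M[C]_(k, N - k) : normedModType C)) :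
  differentiable chP Z.
Proof.
apply: differentiableD; first exact: differentiable_cst.
by apply: differentiable_mulmx => //; exact: differentiable_cst.
Qed.

End Chart.

Lemma gr_param_cover (p : Gr) :
  exists c, exists2 Z, [set: 'M[C]_(k, N - k)] Z & gr_param c Z = p.
Proof.
case: p => p pk; have [A Af Ap] := rowspan_basis (eqP pk).
have [|B Bf Bp] := rowspan_basis (U := (p^C)%VS) (m := (N - k)%N).
  by rewrite dimv_compl (eqP pk) dimvf /dim /= mul1n.
have f : row_free (col_mx A B).
  apply: inj_row_free => v; rewrite -[v]hsubmxK mul_row_col => v0.
  have e : lsubmx v *m A = 0.
    apply/eqP; rewrite -memv0 -(capv_compl p) memv_cap -{1}Ap -Bp !mem_rowspan.
    rewrite submxMl /=; move/eqP: v0; rewrite addr_eq0 => /eqP ->.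
    by rewrite -mulNmx submxMl.
  move: v0; rewrite e add0r => v0.
  have -> : lsubmx v = 0 by apply: (row_free_inj Af); rewrite mul0mx.
  have -> : rsubmx v = 0 by apply: (row_free_inj Bf); rewrite mul0mx.
  by rewrite row_mx0.
exists (exist _ (A, B) f), 0 => //; apply: val_inj => /=.
by rewrite /chP mul0mx addr0.
Qed.

Let model : normedModType C := 'M[C]_(k, N - k).

Section Transition.
Variables (c d : gr_chart) (Z Z' : model).
Hypothesis cd : gr_param c Z = gr_param d Z'.

Lemma near_chart_unit : \forall w \near Z, chP c w *m cha d \in unitmx.
Proof.
apply: near_unitmx.
  by apply: differentiable_mulmx; [exact: differentiable_chP|
    exact: differentiable_cst].
exact: gr_dom_unit (congr1 sval cd).
Qed.
End Transition.

Lemma gr_param_compat (c d : gr_chart) (Z Z' : model) :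
  setT Z -> setT Z' -> gr_param c Z = gr_param d Z' ->
  exists h : model -> model, \forall w \near Z,
      [/\ setT (h w), gr_param d (h w) = gr_param c w & differentiable h w].
Proof.
move=> _ _ cd; exists (fun w => gr_coord d (chP c w)).
apply: filterS (near_chart_unit cd) => w u; split => //.
  by apply: val_inj; exact: rowspan_coord.
apply: differentiable_mulmx.
  apply: differentiable_invmx => //.
  by apply: differentiable_mulmx; [exact: differentiable_chP|
    exact: differentiable_cst].
by apply: differentiable_mulmx; [exact: differentiable_chP|
  exact: differentiable_cst].
Qed.

Definition gr_atlas : holoAtlas 'M[C]_(k, N - k) Gr :=
  @HoloAtlas R 'M[C]_(k, N - k) Gr gr_chart (fun=> setT) gr_param
    (fun=> openT) (fun c u v _ _ => @gr_param_inj c u v) gr_param_cover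
    gr_param_compat.

Lemma gr_dom_open (d : gr_chart) : open_in gr_atlas (gr_dom d).
Proof.
move=> c u _ [Z' _ e]; apply: filterS (near_chart_unit (esym e)) => w u'.
by exists (gr_coord d (chP c w)) => //; apply: val_inj; exact: rowspan_coord.
Qed.

Lemma gr_dom_cover (p : Gr) : exists d, gr_dom d p.
Proof. by have [c [Z _ e]] := gr_param_cover p; exists c, Z. Qed.

Definition taut_triv (c : gr_chart) (p : Gr) :
    'Hom(subvs_of (sval p), 'rV[C]_k) :=
  linfun (mulmxr (cha c) \o vsval).

Lemma taut_trivE c p v : taut_triv c p v = vsval v *m cha c.
Proof. by rewrite lfunE. Qed.

Lemma taut_triv_bij c p : gr_dom c p -> bijective (taut_triv c p).
Proof.
move=> [Z _ <-]; apply: hom_bijP => [v|x].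
  rewrite taut_trivE => v0; apply: val_inj => /=.
  have /submxP[x e] : (vsval v <= chP c Z)%MS by rewrite -mem_rowspan subvsP.
  by move: v0; rewrite e -mulmxA chPa mulmx1 => ->; rewrite mul0mx.
exists (vsproj _ (x *m chP c Z)); rewrite taut_trivE vsprojK.
  by rewrite -mulmxA chPa mulmx1.
by rewrite /= mem_rowspan submxMl.
Qed.

Lemma taut_triv_compat c d p : gr_dom c p -> gr_dom d p ->
  holo_at gr_atlas (fun q => trans_mx (taut_triv c q) (taut_triv d q)) p.
Proof.
move=> pc pd e u _ eu.
have nc := gr_dom_open I (eq_ind_r _ pc eu).
have [Zc _ ec] := pc.
have uc := near_chart_unit (etrans eu (esym ec)).
pose g w := invmx (chP e w *m cha c) *m (chP e w *m cha d).
have dg : differentiable g u.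
  apply: differentiable_mulmx.
    apply: differentiable_invmx; last exact: nbhs_singleton uc.
    by apply: differentiable_mulmx; [exact: differentiable_chP|
      exact: differentiable_cst].
  by apply: differentiable_mulmx; [exact: differentiable_chP|
    exact: differentiable_cst].
apply: near_differentiable dg; apply: filterS2 nc uc => w k1 k2.
apply/esym/trans_mx_eq; first exact: taut_triv_bij.
move=> v; rewrite !taut_trivE.
have /submxP[x ->] : (vsval v <= chP e w)%MS by rewrite -mem_rowspan subvsP.
have gE : chP e w *m cha c *m g w = chP e w *m cha d by rewrite mulKVmx.
by rewrite -(mulmxA x) -gE !mulmxA.
Qed.

(* The tautological bundle H: the fibre over p is p itself.  On the set of
   planes complementary to the span of B, it is trivialised by the projection
   of p to C^N / <B>, identified with C^k by means of A. *)
Definition taut_bundle : holoBundle gr_atlas k :=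
  @HoloBundle R _ Gr gr_atlas k (fun p => subvs_of (sval p)) gr_chart
    gr_dom taut_triv gr_dom_open gr_dom_cover taut_triv_bij taut_triv_compat.

Definition quot_frame (c : gr_chart) (p : Gr) :
    'Hom('rV[C]_(N - k), vquot (sval p)) :=
  linfun (vproj (sval p) \o mulmxr (chB c)).

Definition quot_triv (c : gr_chart) (p : Gr) :
  'Hom(vquot (sval p), 'rV[C]_(N - k)) := (quot_frame c p)^-1%VF.

Lemma quot_frameE c p y : quot_frame c p y = vproj (sval p) (y *m chB c).
Proof. by rewrite lfunE. Qed.

Lemma quot_frame_bij c p : gr_dom c p -> bijective (quot_frame c p).
Proof.
move=> [Z _ <-]; apply: hom_bijP => [y|q].
  rewrite quot_frameE => /eqP; rewrite -[X in _ == X](linear0 (vproj _)).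
  rewrite vproj_eq subr0 /= mem_rowspan => /submxP[x e].
  have := congr1 (mulmx^~ (cha c)) e; rewrite -!mulmxA chPa chBa.
  rewrite mulmx0 mulmx1 => x0; move: e; rewrite -x0 mul0mx => e.
  by rewrite -[y]mulmx1 -(chBb c) mulmxA e mul0mx.
have [v ->] := vprojP q.
exists (v *m chb c - v *m cha c *m Z); rewrite quot_frameE; apply/eqP.
rewrite vproj_eq /= mem_rowspan; apply/submxP; exists (v *m cha c).
rewrite -{1}[v]mulmx1 -(ch1 c) mulmxDr mulmxBl !mulmxA opprB addrA.
by rewrite addrAC addrK mulmxDr mulmxA.
Qed.

Lemma quot_triv_bij c p : gr_dom c p -> bijective (quot_triv c p).
Proof. by move=> pc; apply: hom_inv_bij; exact: quot_frame_bij. Qed.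

Lemma quot_triv_compat c d p : gr_dom c p -> gr_dom d p ->
  holo_at gr_atlas (fun q => trans_mx (quot_triv c q) (quot_triv d q)) p.
Proof.
move=> pc pd e u _ eu.
have nc := gr_dom_open I (eq_ind_r _ pc eu).
have nd := gr_dom_open I (eq_ind_r _ pd eu).
have [Zd _ ed] := pd.
have ud := near_chart_unit (etrans eu (esym ed)).
pose m w := chB c *m cha d *m invmx (chP e w *m cha d).
pose g w := (chB c - m w *m chP e w) *m chb d.
have dg : differentiable g u.
  apply: differentiable_mulmx; last exact: differentiable_cst.
  apply: differentiableB; first exact: differentiable_cst.
  apply: differentiable_mulmx; last exact: differentiable_chP.
  apply: differentiable_mulmx; first exact: differentiable_cst.
  apply: differentiable_invmx; last exact: nbhs_singleton ud.
  by apply: differentiable_mulmx; [exact: differentiable_chP|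
    exact: differentiable_cst].
apply: near_differentiable dg; apply: filterS3 nc nd ud => w k1 k2 k3.
apply/esym/trans_mx_eq; first exact: quot_triv_bij.
have bc := quot_frame_bij k1; have bd := quot_frame_bij k2.
move=> v; apply: (bij_inj bd); rewrite hom_bij_invVK//.
rewrite -{1}[v](hom_bij_invVK bc) -/(quot_triv c _ v).
move: (quot_triv c _ v) => y; rewrite !quot_frameE; apply/eqP.
rewrite vproj_eq /= mem_rowspan; apply/submxP; exists (y *m m w).
have gB : g w *m chB d = chB c - m w *m chP e w.
  rewrite -[RHS]mulmx1 -(ch1 d) mulmxDr mulmxA mulmxA.
  suff -> : (chB c - m w *m chP e w) *m cha d = 0 by rewrite mul0mx add0r.
  by rewrite mulmxBl -mulmxA mulmxKV// subrr.
rewrite -(mulmxA y (g w)) -(mulmxA y (m w)) gB -mulmxBr.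
by rewrite opprB addrC subrK.
Qed.

(* The quotient bundle F = C^N / H: on the set of planes complementary to the
   span of B, the classes of the rows of B are a holomorphic frame. *)
Definition quot_bundle : holoBundle gr_atlas (N - k) :=
  @HoloBundle R _ Gr gr_atlas (N - k) (fun p => vquot (sval p)) gr_chart
    gr_dom quot_triv gr_dom_open gr_dom_cover quot_triv_bij quot_triv_compat.

(* The bundle Hom(H_zeta, F_z), i.e. F_z tensored with the dual of H_zeta, over
   the points x = (z, zeta). *)
Definition hom_taut_quot : holoBundle (prod_atlas gr_atlas gr_atlas)
    (k * (N - k)) :=
  hom_bundle
    (pullback_bundle (@holo_map_snd _ _ _ _ _ gr_atlas gr_atlas) taut_bundle)
    (pullback_bundle (@holo_map_fst _ _ _ _ _ gr_atlas gr_atlas) quot_bundle).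

Definition eta (x : Gr * Gr) : fiber hom_taut_quot x :=
  linfun (vproj (sval x.1) \o (vsval : subvs_of (sval x.2) -> 'rV[C]_N)).

Lemma etaE x v : eta x v = vproj (sval x.1) (vsval v).
Proof. by rewrite lfunE. Qed.

End Grassmannian.

(* Main.v *)
Require Import Defs.
From mathcomp Require Import all_boot all_order all_algebra.
From mathcomp Require Import all_classical all_reals all_analysis.
From mathcomp Require Import complex.

(** Away from the diagonal the claim is linear algebra: eta vanishes at
    (z, zeta) exactly when zeta is contained in z, and since both planes have
    dimension k this forces z = zeta ([eta_neq0]; [eta_diag] is the converse).

    Everything else follows from one explicit formula for eta in coordinates.
    Write z as the row span of P = A + Z B and zeta as the row span of
    Q = A' + W B', in affine charts of the Grassmannian.  The quotient C^N / z,
    in the frame given by the classes of some basis vectors, is the target of an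
    N x (N - k) matrix S(Z) that kills exactly z ([quot_mx],
    [quot_triv_vproj]), and a vector of zeta is determined by its image under an
    N x k matrix a, which is invertible on zeta.  Hence eta is given by the
    k x (N - k) matrix

      (Q a)^-1 (Q S(Z))     ([eta_coord], [triv_eta]),

    which is a composition of polynomial maps and matrix inversions, hence
    holomorphic ([differentiable_eta_coord], [holo_eta]).

    For the first order vanishing it is enough to move zeta and to keep z fixed.
    At a point of the diagonal Q S = 0, so along the line W + h H the formula
    becomes exactly h (Q_h a)^-1 H (B' S), where Q_h is the value of Q at
    W + h H ([eta_coord_line]).  Its derivative at h = 0 is (Q a)^-1 H (B' S).
    The matrix B' S is invertible because the rows of B' span a complement of z
    ([chB_quot_mx_unit]), so H can be chosen to reach any prescribed matrix, and
    the differential is onto. *)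

Set Implicit Arguments.
Unset Strict Implicit.
Unset Printing Implicit Defensive.
Import Order.TTheory GRing.Theory Num.Theory.
Import numFieldNormedType.Exports VectorInternalTheory.

Local Open Scope classical_set_scope.
Local Open Scope ring_scope.

Section Differentials.
Variables (K : numFieldType) (V : normedModType K).

(** When the increment of f along a line is h times a function of h that is
    continuous at 0, the directional derivative is read off without the product
    and chain rules. *)
Lemma diff_divided (W : normedModType K) (f : V -> W) (g : K -> W) x v :
  differentiable f x -> g @ 0 --> g 0 ->
  (\forall h \near (0 : K), f (h *: v + x) - f x = h *: g h) -> 'd f x v = g 0.
Proof.
move=> df cg fg; rewrite -deriveE//; apply: cvg_lim => //.
have cg' : g @ 0^' --> g 0 by exact: cvg_within_filter.
apply: cvg_trans cg'; apply: near_eq_cvg.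
rewrite near_withinE; apply: filterS fg => h /= fgh h0.
by rewrite fgh scalerA mulVf// scale1r.
Qed.

Lemma differentiable_line (v x : V) (h : K) :
  differentiable (fun a : K => a *: v + x) h.
Proof.
apply: differentiableD; last exact: differentiable_cst.
apply: (@differentiableZl _ K V id); exact: ex_diff.
Qed.

Lemma near_line (P : set V) (v x : V) :
  (\forall w \near x, P w) -> \forall h \near (0 : K), P (h *: v + x).
Proof.
move=> Px; have lx : (fun a : K => a *: v + x) @ 0 --> x.
  rewrite -[X in _ --> X]add0r -(scale0r v).
  exact: differentiable_continuous (differentiable_line v x 0).
exact: lx Px.
Qed.

Lemma differentiable_mxvec m n (M : V -> 'M[K]_(m, n)) x :
  differentiable M x -> differentiable (fun y => mxvec (M y)) x.
Proof.
move=> dM; apply: differentiable_mxP => i j; rewrite (ord1 i).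
case/mxvec_indexP: j => a b; under eq_fun do rewrite mxvecE.
exact: differentiable_entry.
Qed.

End Differentials.

Section EtaInCoordinates.
Variables (R : realType) (k N : nat).
Local Notation C := R[i].
Implicit Types c d s t : gr_chart R k N.

(** The projection of C^N onto the span of B along the plane of coordinate Z,
    expressed in the basis B: the coordinate form of C^N -> C^N / z. *)
Definition quot_mx d (Z : 'M[C]_(k, N - k)) : 'M[C]_(N, N - k) :=
  chb d - cha d *m Z.

Lemma quot_mx_chB d Z : quot_mx d Z *m chB d = 1%:M - cha d *m chP d Z.
Proof.
rewrite /quot_mx /chP mulmxBl mulmxDr -(ch1 d) -mulmxA opprD addrA.
by rewrite [cha d *m chA d + _]addrC addrK.
Qed.

Lemma chP_quot_mx d Z : chP d Z *m quot_mx d Z = 0.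
Proof. by rewrite /quot_mx mulmxBr mulmxA chPa chPb mul1mx subrr. Qed.

Lemma chB_quot_mx d Z : chB d *m quot_mx d Z = 1%:M.
Proof. by rewrite /quot_mx mulmxBr mulmxA chBa chBb mul0mx subr0. Qed.

Lemma rowspan_quot_mx d Z m (P : 'M[C]_(m, N)) :
  rowspan P = rowspan (chP d Z) -> P *m quot_mx d Z = 0.
Proof.
move=> /eqP; rewrite eqEsubv => /andP[/rowspan_subP[Q ->] _].
by rewrite -mulmxA chP_quot_mx mulmx0.
Qed.

Lemma quot_triv_vproj d Z p v : gr_param d Z = p ->
  quot_triv d p (vproj (sval p) v) = v *m quot_mx d Z.
Proof.
move=> <-; have bd : bijective (quot_frame d (gr_param d Z)).
  by apply: quot_frame_bij; exists Z.
apply: (bij_inj bd); rewrite hom_bij_invVK// quot_frameE; apply/eqP.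
rewrite vproj_eq /= mem_rowspan -mulmxA quot_mx_chB mulmxBr mulmx1 subKr mulmxA.
exact: submxMl.
Qed.

(** The rows of B span a complement of every plane of the chart c, so their
    classes are a basis of the quotient by such a plane, in whichever chart d the
    quotient is computed. *)
Lemma chB_quot_mx_unit c d Z W :
  gr_param c W = gr_param d Z -> chB c *m quot_mx d Z \in unitmx.
Proof.
move=> /(congr1 sval)/= /rowspan_quot_mx e.
(* The projection along the plane, followed by re-expansion in the rows of B,
   changes a vector by an element of the plane, which quot_mx d Z kills. *)
have qS : quot_mx c W *m (chB c *m quot_mx d Z) = quot_mx d Z.
  by rewrite mulmxA quot_mx_chB mulmxBl mul1mx -mulmxA e mulmx0 subr0.
have : (chB d *m quot_mx c W) *m (chB c *m quot_mx d Z) = 1%:M.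
  by rewrite -mulmxA qS chB_quot_mx.
by move/mulmx1_unit => [].
Qed.

(** The matrix of eta at the point with coordinates w = (Z, W) in the charts
    (c, d), in the trivialisations of H_zeta and F_z given by s and t. *)
Definition eta_coord c d s t
    (w : ('M[C]_(k, N - k) * 'M[C]_(k, N - k))%type) : 'M[C]_(k, N - k) :=
  invmx (chP d w.2 *m cha s) *m
  (chP d w.2 *m quot_mx t (gr_coord t (chP c w.1))).

Lemma mulmx_eta_coord c d s t Z W (x : 'rV[C]_k) :
  chP d W *m cha s \in unitmx ->
  x *m chP d W *m quot_mx t (gr_coord t (chP c Z)) =
  x *m chP d W *m cha s *m eta_coord c d s t (Z, W).
Proof.
by move=> uQ; rewrite -[in RHS](mulmxA x) -[in RHS]mulmxA mulKVmx// mulmxA.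
Qed.

(** A vector x Q of zeta has coordinate x Q a in H_zeta, and its class has
    coordinate x Q S in F_z. *)
Lemma triv_eta c d s t Z W :
  gr_dom t (gr_param c Z) -> gr_dom s (gr_param d W) ->
  triv (h := hom_taut_quot R k N) (s, t) (gr_param c Z, gr_param d W)
    (eta (gr_param c Z, gr_param d W)) = mxvec (eta_coord c d s t (Z, W)).
Proof.
move=> tz sw; rewrite [LHS]lfunE -[LHS]vec_mxK; congr mxvec.
have bs := taut_triv_bij sw.
have [Z' _ /(congr1 sval)/esym/= eZ] := tz.
have [W' _ /(congr1 sval)/esym/= eW] := sw.
have uQ : chP d W *m cha s \in unitmx := gr_dom_unit eW.
have et : gr_param t (gr_coord t (chP c Z)) = gr_param c Z.
  by apply: val_inj; apply: rowspan_coord; exact: gr_dom_unit eZ.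
apply/row_matrixP => i; rewrite !rowE.
have [v ->] : exists v, delta_mx 0 i = taut_triv s (gr_param d W) v.
  exists ((taut_triv s (gr_param d W))^-1%VF (delta_mx 0 i)).
  by rewrite hom_bij_invVK.
rewrite hom_coordE//=.
rewrite [LHS](congr1 (quot_triv t (gr_param c Z)) (etaE (x := (_, _)) v)).
rewrite (quot_triv_vproj _ et) [RHS](congr1 (mulmx^~ _) (taut_trivE s v)).
have /submxP[x ->] : (vsval v <= chP d W)%MS by rewrite -mem_rowspan subvsP.
exact: mulmx_eta_coord.
Qed.

Lemma eta_neq0 (x : Gr R k N * Gr R k N) : x.1 <> x.2 -> eta x <> 0.
Proof.
move=> ne e0; apply: ne; apply/val_inj/esym/eqP.
case: x e0 => [[z hz] [u hu]] /= e0.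
rewrite eqEdim (eqP hz) (eqP hu) leqnn andbT; apply/subvP => v vu.
have := etaE (x := (exist _ z hz, exist _ u hu)) (vsproj u v).
rewrite e0 lfunE /= vsprojK// => /esym/eqP.
by rewrite -[X in _ == X](linear0 (vproj _)) vproj_eq subr0.
Qed.

Lemma eta_diag (x : Gr R k N * Gr R k N) : x.1 = x.2 -> eta x = 0.
Proof.
case: x => z u /= <-; apply/lfunP => v.
apply: etrans (etaE (x := (z, z)) v) _; rewrite lfunE /=; apply/eqP.
rewrite -[X in _ == X](linear0 (vproj _)) vproj_eq subr0; exact: subvsP.
Qed.

Let model : normedModType C := 'M[C]_(k, N - k).

(** The two conditions say that z and zeta lie in the domains of t and s, where
    the inverses that occur in [eta_coord] are genuine inverses. *)
Lemma differentiable_eta_coord c d s t (w : (model * model)%type) :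
  chP c w.1 *m cha t \in unitmx -> chP d w.2 *m cha s \in unitmx ->
  differentiable (eta_coord c d s t : model * model -> model) w.
Proof.
move=> uP uQ.
have dP : differentiable (fun y : (model * model)%type => chP c y.1) w.
  apply: differentiable_comp; first exact: differentiable_fst.
  exact: differentiable_chP.
have dQ : differentiable (fun y : (model * model)%type => chP d y.2) w.
  apply: differentiable_comp; first exact: differentiable_snd.
  exact: differentiable_chP.
have dmul m (A : model * model -> 'M[C]_(k, N)) (B : 'M[C]_(N, m)) :
    differentiable A w -> differentiable (fun y => A y *m B) w.
  move=> dA; apply: differentiable_mulmx; first exact: dA.
  exact: differentiable_cst.
apply: differentiable_mulmx.
  by apply: differentiable_invmx; [exact: dmul|exact: uQ].
apply: differentiable_mulmx; first exact: dQ.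
apply: differentiableB; first exact: differentiable_cst.
apply: differentiable_mulmx; first exact: differentiable_cst.
apply: differentiable_mulmx; last exact: dmul.
by apply: differentiable_invmx; [exact: dmul|exact: uP].
Qed.

Lemma near_triv_eta (c t : gr_chart R k N * gr_chart R k N)
    (u : (model * model)%type) :
  triv_dom (h := hom_taut_quot R k N) t (gr_param c.1 u.1, gr_param c.2 u.2) ->
  \forall w \near u,
    mxvec (eta_coord c.1 c.2 t.1 t.2 w) =
    triv (h := hom_taut_quot R k N) t (gr_param c.1 w.1, gr_param c.2 w.2)
      (eta (gr_param c.1 w.1, gr_param c.2 w.2)).
Proof.
move=> tu.
have := @triv_dom_open _ _ _ _ _ (hom_taut_quot R k N) t c u (conj I I) tu.
apply: filterS => -[Z W] [/= hs ht].
by case: t {tu} hs ht => s t /= hs ht; rewrite -triv_eta.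
Qed.

Lemma holo_eta : holo_section (E := hom_taut_quot R k N) (@eta R k N).
Proof.
move=> t x tx c u _ ux; move: tx; rewrite -{}ux => tu.
apply: near_differentiable (near_triv_eta tu) _; apply: differentiable_mxvec.
case: tu => [[W _ /(congr1 sval)/esym/= eW] [Z _ /(congr1 sval)/esym/= eZ]].
apply: differentiable_eta_coord; first exact: gr_dom_unit eZ.
exact: gr_dom_unit eW.
Qed.

(** On the diagonal Q S = 0, so that moving zeta alone leaves only the linear
    part h H B of Q in the second factor: the formula is exact, not merely of
    first order in h. *)
Lemma eta_coord_line c d s t (u : (model * model)%type) H h :
  gr_param c u.1 = gr_param d u.2 -> gr_dom t (gr_param c u.1) ->
  eta_coord c d s t (h *: (0, H) + u) =
  h *: (invmx (chP d (h *: H + u.2) *m cha s) *m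
        (H *m (chB d *m quot_mx t (gr_coord t (chP c u.1))))).
Proof.
case: u => Z W /= e [Z' _ /(congr1 sval)/esym/= eZ].
rewrite /eta_coord /= scaler0 add0r scalemxAr; congr (_ *m _).
have e0 : chP d W *m quot_mx t (gr_coord t (chP c Z)) = 0.
  apply: rowspan_quot_mx; rewrite rowspan_coord; last exact: gr_dom_unit eZ.
  exact: esym (congr1 sval e).
have -> : chP d (h *: H + W) = h *: (H *m chB d) + chP d W.
  by rewrite /chP mulmxDl -scalemxAl addrCA.
by rewrite mulmxDl e0 addr0 -scalemxAl mulmxA.
Qed.

Lemma eta_vanishes_first_order :
  vanishes_first_order (E := hom_taut_quot R k N) (@eta R k N)
    [set x : Gr R k N * Gr R k N | x.1 = x.2].
Proof.
move=> x Dx; split; first exact: eta_diag.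
move=> c u t _ ux; move: Dx; rewrite -{}ux /= => e tu.
pose f w :=
  triv (h := hom_taut_quot R k N) t (gr_param c.1 w.1, gr_param c.2 w.2)
    (eta (gr_param c.1 w.1, gr_param c.2 w.2)).
have df : differentiable (f : model * model -> 'rV[C]_(k * (N - k))) u.
  exact: (@holo_eta t (gr_param c.1 u.1, gr_param c.2 u.2) tu c u
    (conj I I) erefl).
split; first exact: df.
rewrite -subTset => y _.
have [[W _ /(congr1 sval)/esym/= eW] tz] := tu.
have [Z _ /(congr1 sval)/esym/= eZ] := tz.
have uQ := gr_dom_unit eW.
pose B := chB c.2 *m quot_mx t.2 (gr_coord t.2 (chP c.1 u.1)).
have uB : B \in unitmx.
  apply: (chB_quot_mx_unit (W := u.2)); rewrite -e; apply/val_inj/esym.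
  by apply: rowspan_coord; exact: gr_dom_unit eZ.
(* H solves (Q a)^-1 H B = y, where the left-hand side is the derivative of the
   divided expression of eta_coord_line at h = 0. *)
pose H : model := chP c.2 u.2 *m cha t.1 *m vec_mx y *m invmx B.
pose g (h : C) :=
  mxvec (invmx (chP c.2 (h *: H + u.2) *m cha t.1) *m (H *m B)).
have g0 : g 0 = y.
  rewrite /g scale0r add0r (mulmxKV uB (chP c.2 u.2 *m cha t.1 *m vec_mx y)).
  by rewrite (mulKmx uQ (vec_mx y)) vec_mxK.
exists (0, H); first exact: I.
rewrite -[RHS]g0; apply: (diff_divided df).
  apply: differentiable_continuous; apply: differentiable_mxvec.
  apply: differentiable_mulmx; last exact: differentiable_cst.
  apply: differentiable_invmx; last by rewrite scale0r add0r.
  apply: differentiable_mulmx; last exact: differentiable_cst.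
  apply: differentiable_comp; first exact: differentiable_line.
  exact: differentiable_chP.
have fu : f u = 0.
  by rewrite /f (eta_diag (x := (_, _)) e) linear0.
apply: filterS (near_line (0, H) (near_triv_eta tu)) => h fh.
rewrite fu subr0 -[LHS]fh (eta_coord_line t.1 H h e tz).
exact: linearZ.
Qed.

End EtaInCoordinates.

Theorem proposition12 (R : realType) (k N : nat)
    (hk : (1 <= k <= N - 1)%N) :
  [/\ holo_section (E := hom_taut_quot R k N) (@eta R k N),
      vanishes_first_order (E := hom_taut_quot R k N) (@eta R k N)
        [set x : Gr R k N * Gr R k N | x.1 = x.2]
    & forall x : Gr R k N * Gr R k N, x.1 <> x.2 -> @eta R k N x <> 0].
Proof.
split; [exact: holo_eta|exact: eta_vanishes_first_order|exact: eta_neq0].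
Qed.
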